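(* Let $(a_n)\in\ell_1$ with $\|(a_n)\|_1=1$, regarded as a functional on $c_0$. Then $\ker (a_n)=\{(x_n)\in c_0:\sum_n a_nx_n=0\}$ has property-$SU$ in $c_0$ if and only if $\sup_{n\in\mathbb{N}}|a_n|>\frac12$.
   Context: Scalars are real; $c_0$ carries the sup norm and $c_0^*=\ell_1$ via $(a_n)\big((x_n)\big)=\sum_n a_nx_n$. For a closed subspace $Y$ of a Banach space $X$, $Y^\perp\subseteq X^*$ denotes the annihilator of $Y$. $Y$ has property-$SU$ in $X$ if $Y^\perp$ has a complementary subspace $G\subseteq X^*$ such that for every $f\in X^*$, writing $f=g+h$ with $g\in G$, $h\in Y^\perp$, one has $\|f\|>\|g\|$ whenever $h\neq 0$. *)

(* Defs.v *)
From HB Require Import structures.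
From mathcomp Require Import all_boot all_order all_algebra.
From mathcomp Require Import all_classical all_reals all_analysis.

Set Implicit Arguments.
Unset Strict Implicit.
Unset Printing Implicit Defensive.
Import Order.TTheory GRing.Theory Num.Theory.
Import numFieldNormedType.Exports.

Local Open Scope classical_set_scope.
Local Open Scope ring_scope.

Section dual_space.
Context {R : realType} {X : normedModType R}.

Definition continuous_linear : {pred X -> R} :=
  mem [set f : X -> R | linear f /\ continuous f].

Lemma continuous_linear_submod_closed : submod_closed continuous_linear.
Proof.
split.
  apply/mem_set; split; last by move=> x; exact: cvg_cst.
  by move=> k x y; rewrite /= scaler0 addr0.
move=> k f g /set_mem[fl fc] /set_mem[gl gc]; apply/mem_set; split.
  move=> c x y; rewrite !fctE fl gl !scalerDr !scalerA (mulrC k c).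
  by rewrite addrACA.
by move=> x; apply: cvgD; [apply: cvgZr; exact: fc | exact: gc].
Qed.

HB.instance Definition _ := GRing.isSubmodClosed.Build R (X -> R)
  continuous_linear continuous_linear_submod_closed.

End dual_space.

Record dual (R : realType) (X : normedModType R) := Dual {
  dual_fun :> X -> R;
  dualP : dual_fun \in continuous_linear }.

HB.instance Definition _ (R : realType) (X : normedModType R) :=
  [isSub of dual X for @dual_fun R X].
HB.instance Definition _ (R : realType) (X : normedModType R) :=
  [Choice of dual X by <:].
HB.instance Definition _ (R : realType) (X : normedModType R) :=
  [SubChoice_isSubLmodule of dual X by <:].

Section dual_norm.
Context {R : realType} {X : normedModType R}.
Implicit Types f g : dual X.

Definition dual_norm f : R := sup [set `|f x| | x in [set x : X | `|x| <= 1]].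

Lemma dual_linear f : linear f.
Proof. by have /set_mem[] := dualP f. Qed.

Lemma dual_continuous f : continuous f.
Proof. by have /set_mem[] := dualP f. Qed.

HB.instance Definition _ f :=
  GRing.isLinear.Build R X R *%R (dual_fun f) (dual_linear f).

Lemma dual_bounded f : exists M, forall x, `|f x| <= M * `|x|.
Proof.
have /linear_bounded_continuous/linear_boundedP fb := @dual_continuous f.
near +oo_R => M; exists M; near: M; exact: fb.
Unshelve. all: by end_near. Qed.

Lemma dual_has_sup f :
  has_sup [set `|f x| | x in [set x : X | `|x| <= 1]].
Proof.
split; first by exists `|f 0|, 0 => //=; rewrite normr0.
have [M fM] := dual_bounded f.
exists `|M| => _ [x /= x1 <-]; apply: (le_trans (fM x)).
apply: (@le_trans _ _ (`|M| * `|x|)); first by rewrite ler_wpM2r// ler_norm.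
by rewrite ler_piMr.
Qed.

Lemma ler_dual_norm f x : `|x| <= 1 -> `|f x| <= dual_norm f.
Proof.
by move=> x1; apply: sup_upper_bound; [exact: dual_has_sup | exists x].
Qed.

Lemma dual_norm_ge0 f : 0 <= dual_norm f.
Proof. by apply: le_trans (@ler_dual_norm f 0 _); rewrite ?normr0. Qed.

Lemma dual_norm_le f r :
  (forall x, `|x| <= 1 -> `|f x| <= r) -> dual_norm f <= r.
Proof.
move=> fr; apply: ge_sup; first by have [] := dual_has_sup f.
by move=> _ [x /= x1 <-]; exact: fr.
Qed.

Lemma dual_normD f g : dual_norm (f + g) <= dual_norm f + dual_norm g.
Proof.
apply: dual_norm_le => x x1; apply: le_trans (ler_normD _ _) _.
by apply: lerD; exact: ler_dual_norm.
Qed.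

Lemma dual_normZ_le k f : dual_norm (k *: f) <= `|k| * dual_norm f.
Proof.
apply: dual_norm_le => x x1; rewrite [X in `|X|](_ : _ = k * f x)// normrM.
by rewrite ler_wpM2l//; exact: ler_dual_norm.
Qed.

Lemma dual_normZ k f : dual_norm (k *: f) = `|k| * dual_norm f.
Proof.
apply/eqP; rewrite eq_le dual_normZ_le/=.
have [->|k0] := eqVneq k 0; first by rewrite normr0 mul0r dual_norm_ge0.
rewrite -{1}[f](scalerK k0) -ler_pdivlMl ?normr_gt0// -normfV.
exact: dual_normZ_le.
Qed.

Lemma dual_norm0_eq0 f : dual_norm f = 0 -> f = 0.
Proof.
move=> f0; apply/val_inj/funext => x /=.
have [->|x0] := eqVneq x 0; first by rewrite linear0.
have : `|f (`|x|^-1 *: x)| <= 0.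
  by rewrite -f0; apply: ler_dual_norm; rewrite normfZV.
by rewrite normr_le0 linearZ mulf_eq0 invr_eq0 normr_eq0 (negbTE x0) => /eqP.
Qed.

HB.instance Definition _ := @Lmodule_isNormed.Build R (dual X) dual_norm
  dual_normD dual_normZ dual_norm0_eq0.

End dual_norm.

Definition annihilator (R : realType) (X : normedModType R) (Y : set X) :
  set (dual X) := [set f : dual X | forall y, Y y -> f y = 0].

(* [G] is not asked to be closed: in [property_SU] the norm condition bounds
   the projection onto [G] along [H], so closedness of [G] is automatic. *)
Definition complementary_subspace (R : realType) (V : lmodType R)
    (H G : set V) : Prop :=
  [/\ submod_closed [in G],
      G `&` H = [set 0] &
      forall f, exists g h, [/\ G g, H h & f = g + h]].

(* Meant for closed subspaces [Y]. *)
Definition property_SU (R : realType) (X : completeNormedModType R)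
    (Y : set X) : Prop :=
  exists G : set (dual X),
    complementary_subspace (annihilator Y) G /\
    forall f g h : dual X, G g -> annihilator Y h -> f = g + h ->
      h != 0 -> `|f| > `|g|.

Section c0_space.
Context {R : realType}.

Definition null_sequence : {pred nat -> R} :=
  mem [set u : nat -> R | u @ \oo --> (0 : R)].

Lemma null_sequence_submod_closed : submod_closed null_sequence.
Proof.
split; first by apply/mem_set; exact: cvg_cst.
move=> k u v /set_mem u0 /set_mem v0; apply/mem_set.
rewrite /mkset -[X in _ --> X](addr0 (0 : R)) -{1}(mulr0 k).
by apply: cvgD => //; exact: cvgMr.
Qed.

HB.instance Definition _ := GRing.isSubmodClosed.Build R (nat -> R)
  null_sequence null_sequence_submod_closed.

End c0_space.

Record c0 (R : realType) := C0 {
  c0_seq :> nat -> R;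
  c0P : c0_seq \in null_sequence }.

HB.instance Definition _ (R : realType) := [isSub of c0 R for @c0_seq R].
HB.instance Definition _ (R : realType) := [Choice of c0 R by <:].
HB.instance Definition _ (R : realType) :=
  [SubChoice_isSubLmodule of c0 R by <:].

Section c0_norm.
Context {R : realType}.
Implicit Types x y : c0 R.

Definition c0_norm x : R := sup (range (fun n => `|x n|)).

Lemma c0_cvg x : (x : nat -> R) @ \oo --> (0 : R).
Proof. exact: set_mem (c0P x). Qed.

Lemma c0_has_sup x : has_sup (range (fun n => `|x n|)).
Proof.
split; first by exists `|x 0%N|, 0%N.
have : cvgn (fun n => `|x n|) by apply: is_cvg_norm; apply: cvgP (c0_cvg x).
by move=> /cvg_seq_bounded/bounded_fun_has_ubound.
Qed.

Lemma ler_c0_norm x n : `|x n| <= c0_norm x.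
Proof. by apply: sup_upper_bound; [exact: c0_has_sup | exists n]. Qed.

Lemma c0_norm_le x r : (forall n, `|x n| <= r) -> c0_norm x <= r.
Proof.
move=> xr; apply: ge_sup; first by have [] := c0_has_sup x.
by move=> _ [n _ <-]; exact: xr.
Qed.

Lemma c0_norm_ge0 x : 0 <= c0_norm x.
Proof. exact: le_trans (ler_c0_norm x 0%N). Qed.

Lemma c0_normD x y : c0_norm (x + y) <= c0_norm x + c0_norm y.
Proof.
apply: c0_norm_le => n; apply: le_trans (ler_normD _ _) _.
by apply: lerD; exact: ler_c0_norm.
Qed.

Lemma c0_normZ_le k x : c0_norm (k *: x) <= `|k| * c0_norm x.
Proof.
apply: c0_norm_le => n; rewrite [X in `|X|](_ : _ = k * x n)// normrM.
by rewrite ler_wpM2l//; exact: ler_c0_norm.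
Qed.

Lemma c0_normZ k x : c0_norm (k *: x) = `|k| * c0_norm x.
Proof.
apply/eqP; rewrite eq_le c0_normZ_le/=.
have [->|k0] := eqVneq k 0; first by rewrite normr0 mul0r c0_norm_ge0.
rewrite -{1}[x](scalerK k0) -ler_pdivlMl ?normr_gt0// -normfV.
exact: c0_normZ_le.
Qed.

Lemma c0_norm0_eq0 x : c0_norm x = 0 -> x = 0.
Proof.
move=> x0; apply/val_inj/funext => n /=; apply/eqP.
by rewrite -normr_le0 -x0 ler_c0_norm.
Qed.

HB.instance Definition _ := @Lmodule_isNormed.Build R (c0 R) c0_norm
  c0_normD c0_normZ c0_norm0_eq0.

Lemma c0_complete (F : set_system (c0 R)) :
  ProperFilter F -> cauchy F -> cvg F.
Proof.
move=> FF /cauchy_ballP Fc.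
have Fc2 (e : R) : 0 < e ->
    \forall x \near F & y \near F, forall n, `|(x : c0 R) n - (y : c0 R) n| < e.
  move=> e0; have := Fc e e0; apply: filterS => -[x y] /=.
  rewrite -ball_normE/= => xy n.
  exact: le_lt_trans (ler_c0_norm (x - y) n) xy.
have Fn_cvg n : cvg ((fun x : c0 R => x n) @ F).
  apply: cauchy_cvg; apply/cauchy_ballP => e e0.
  have [[P Q] /= [FP FQ] PQ] := Fc2 e e0.
  exists ((fun x : c0 R => x n) @` P, (fun x : c0 R => x n) @` Q) => /=.
    by split; [apply: filterS FP|apply: filterS FQ] => x Px; exists x.
  move=> [_ _] /= [[x Px <-] [y Qy <-]].
  by rewrite -ball_normE/=; exact: (PQ (x, y) (conj Px Qy) n).
pose l n : R := lim ((fun x : c0 R => x n) @ F).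
have Fl (e : R) : 0 < e ->
    \forall x \near F, forall n, `|(x : c0 R) n - l n| <= e.
  move=> e0; have [[P Q] /= [FP FQ] PQ] := Fc2 e e0.
  apply: filterS FP => x Px n.
  have xl : (fun y : c0 R => `|x n - y n|) @ F --> `|x n - l n|.
    by apply: cvg_norm; apply: cvgB; [exact: cvg_cst | exact: Fn_cvg].
  rewrite -(cvg_lim _ xl)//; apply: limr_le; first exact: cvgP xl.
  by apply: filterS FQ => y Qy; apply/ltW; exact: (PQ (x, y) (conj Px Qy) n).
have l0 : l \in null_sequence.
  apply/mem_set; apply/cvgr0Pnorm_le => e e0.
  have e20 : 0 < e / 2 by rewrite divr_gt0.
  have [x xl] := filter_ex (Fl _ e20).
  have /cvgr0Pnorm_le/(_ _ e20) := c0_cvg x; apply: filterS => n xn.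
  rewrite -[l n](subrK (x n)) [leRHS](splitr e).
  by apply: le_trans (ler_normD _ _) _; rewrite lerD// distrC.
apply/cvg_ex; exists (C0 l0); apply/cvgrPdist_le => e e0.
apply: filterS (Fl e e0) => x xl; rewrite distrC.
exact: c0_norm_le.
Qed.

HB.instance Definition _ := Uniform_isComplete.Build (c0 R) c0_complete.

End c0_norm.

(* For non-summable [a] this is the junk value of [limn]. *)
Definition ell1_norm (R : realType) (a : R ^nat) : R :=
  limn (series (fun n => `|a n|)).

Definition ell1 (R : realType) : set (nat -> R) :=
  [set a : R ^nat | cvgn (series (fun n => `|a n|))].

Definition ell1_pairing (R : realType) (a : R ^nat) (x : c0 R) : R :=
  limn (series (fun n => a n * x n)).

Definition c0_ker (R : realType) (a : R ^nat) : set (c0 R) :=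
  [set x | ell1_pairing a x = 0].

Section ell1_dual.
Context {R : realType} (a : R ^nat) (ha : ell1 a).
Implicit Types x y : c0 R.

Lemma ell1_pairing_normed_cvg x : cvgn (series (fun n => `|a n * x n|)).
Proof.
apply: (@series_le_cvg _ _ (fun n => `|a n| * `|x|)) => //.
- by move=> n; rewrite normrM ler_wpM2l//; exact: ler_c0_norm.
- rewrite [X in cvgn X](_ : _ = (fun n => series (fun k => `|a k|) n * `|x|)).
    by apply: is_cvgMl; exact: ha.
  by apply/funext => n /=; rewrite mulr_suml.
Qed.

Lemma ell1_pairing_cvg x : cvgn (series (fun n => a n * x n)).
Proof.
apply: (@normed_cvg R R (fun n => a n * x n)).
exact: ell1_pairing_normed_cvg.
Qed.

Lemma ell1_pairing_le x : `|ell1_pairing a x| <= ell1_norm a * `|x|.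
Proof.
apply: le_trans (@lim_series_norm R R (fun n => a n * x n) _) _.
  exact: ell1_pairing_normed_cvg.
have E : (fun n => series (fun k => `|a k|) n * `|x|) @ \oo --> ell1_norm a * `|x|.
  by apply: cvgMl; exact: ha.
rewrite -(cvg_lim _ E)//; apply: ler_lim.
- exact: ell1_pairing_normed_cvg.
- exact: cvgP E.
- near=> n; rewrite /= mulr_suml; apply: ler_sum => i _.
  by rewrite normrM ler_wpM2l//; exact: ler_c0_norm.
Unshelve. all: by end_near. Qed.

Lemma ell1_pairing_linear : linear (ell1_pairing a).
Proof.
move=> k x y.
have E : k *: series (fun n => a n * x n) + series (fun n => a n * y n) @ \oo
    --> k *: ell1_pairing a x + ell1_pairing a y.
  by apply: cvgD; [apply: cvgZr|]; exact: ell1_pairing_cvg.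
rewrite -(cvg_lim _ E)//; congr (lim (_ @ \oo)); apply/funext => n /=.
rewrite !fctE /series/= scaler_sumr -big_split/=; apply: eq_bigr => i _.
by rewrite mulrDr mulrCA.
Qed.

Lemma ell1_pairing_continuous : continuous (ell1_pairing a).
Proof.
pose h : {linear c0 R -> R} := HB.pack (ell1_pairing a)
  (GRing.isLinear.Build R (c0 R) R *%R _ ell1_pairing_linear).
suff: continuous h by [].
apply: bounded_linear_continuous; apply/linear_boundedP.
near=> r => x; apply: le_trans (ell1_pairing_le x) _.
rewrite ler_wpM2r//; near: r; apply: nbhs_pinfty_ge; exact: num_real.
Unshelve. all: by end_near. Qed.

Definition ell1_functional : dual (c0 R) :=
  Dual (mem_set (conj ell1_pairing_linear ell1_pairing_continuous)).

Lemma c0_ker_closed : closed (c0_ker a).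
Proof.
apply: (@preimage_closed _ _ (ell1_pairing a) [set 0]).
- by move=> x _; exact: ell1_pairing_continuous.
- exact: closed_eq.
Qed.

Lemma c0_ker_submod_closed : submod_closed [in c0_ker a].
Proof.
split; first by apply/mem_set; exact: (linear0 ell1_functional).
move=> k x y /set_mem/= x0 /set_mem/= y0; apply/mem_set.
by rewrite /c0_ker/= ell1_pairing_linear [ell1_pairing a x]x0 y0 scaler0 addr0.
Qed.

End ell1_dual.

(* Main.v *)
(* The annihilator of [ker a] is the line spanned by [a]. If [|a_m| > 1/2], the
   functionals vanishing at [e_m] form the required complement. If all
   [|a_n| <= 1/2], then [||e_n - t a|| >= 1 = ||e_n||] for all [t], so a
   complement [G] with the norm condition contains every [e_n], hence every
   partial sum [p] of [a]; but then [||p - a|| > ||p||], whereas [p] tends to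
   [a] and [||a|| = 1]. *)
Require Import Defs.
From mathcomp Require Import all_boot all_order all_algebra.
From mathcomp Require Import all_classical all_reals all_analysis.
From mathcomp Require Import ring lra.

Set Implicit Arguments.
Unset Strict Implicit.
Import Order.TTheory GRing.Theory Num.Theory.
Import numFieldNormedType.Exports.
Local Open Scope classical_set_scope.
Local Open Scope ring_scope.

(** * Series with finitely many nonzero or modified terms *)

Lemma cvg_series_finite_support (R : realType) (u : R ^nat) (N : nat) :
  (forall n, (N <= n)%N -> u n = 0) ->
  series u @ \oo --> \sum_(0 <= i < N) u i.
Proof.
move=> u0; apply: cvg_near_cst; near=> n.
have Nn : (N <= n)%N by near: n; exact: nbhs_infty_ge.
rewrite /series/= (big_cat_nat (n := N))//= [X in _ + X]big_nat_cond.
by rewrite [X in _ + X]big1 ?addr0// => i /andP[/andP[Ni _] _]; exact: u0.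
Unshelve. all: by end_near. Qed.

(** The same sequence serves twice: as the unit vector [e_m] of [c0], and as the [ell1] coefficients
    of the [m]-th coordinate functional. *)
Definition delta (R : realType) (m n : nat) : R := (n == m)%:R.

Lemma delta_support (R : realType) (m n : nat) :
  (m.+1 <= n)%N -> delta R m n = 0.
Proof. by move=> mn; rewrite /delta gtn_eqF. Qed.

Lemma sum_delta (R : realType) (u : R ^nat) (m : nat) :
  \sum_(0 <= i < m.+1) delta R m i * u i = u m.
Proof.
rewrite big_nat_recr//= {2}/delta eqxx mul1r big_nat big1 ?add0r// => i /= im.
by rewrite /delta ltn_eqF ?mul0r.
Qed.

Lemma cvg_series_eventually_eq (R : realType) (u v : R ^nat) (N : nat)
    (l : R) :
  (forall n, (N <= n)%N -> v n = u n) -> series u @ \oo --> l ->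
  series v @ \oo --> l + \sum_(0 <= i < N) (v i - u i).
Proof.
move=> vu ul; have -> : series v = series u + series (v - u).
  apply/funext => n; rewrite fctE /series/= -big_split/=.
  by apply: eq_bigr => i _; rewrite !fctE addrC subrK.
apply: cvgD => //; apply: cvg_series_finite_support => n /vu vun.
by rewrite !fctE vun subrr.
Qed.

(** This turns the norm of [a] into the norm of [a] with its [m]-th entry deleted or replaced. *)
Lemma cvg_series_update (R : realType) (u : R ^nat) (m : nat) (v l : R) :
  series u @ \oo --> l ->
  series (fun n => if n == m then v else u n) @ \oo --> l + (v - u m).
Proof.
pose w n := if n == m then v else u n.
move=> ul; rewrite -[fun n => _]/w.
have <- : \sum_(0 <= i < m.+1) (w i - u i) = v - u m.
  rewrite big_nat_recr//= [w m]/w eqxx big_nat big1 ?add0r// => i /= im.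
  by rewrite /w ltn_eqF ?subrr.
by apply: cvg_series_eventually_eq => // n mn; rewrite /w gtn_eqF.
Qed.

(** * Unit vectors and coordinate functionals *)

Lemma null_sequence_finite_support (R : realType) (u : R ^nat) (N : nat) :
  (forall n, (N <= n)%N -> u n = 0) -> u \in null_sequence.
Proof.
move=> u0; apply/mem_set; apply: cvg_near_cst; near=> n.
by apply: u0; near: n; exact: nbhs_infty_ge.
Unshelve. all: by end_near. Qed.

Definition c0_unit (R : realType) (m : nat) : c0 R :=
  C0 (null_sequence_finite_support (@delta_support R m)).

Lemma ell1_finite_support (R : realType) (u : R ^nat) (N : nat) :
  (forall n, (N <= n)%N -> u n = 0) -> ell1 u.
Proof.
move=> u0; apply: cvgP (cvg_series_finite_support (N := N) _) => n Nn.
by rewrite u0// normr0.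
Qed.

Definition coord (R : realType) (m : nat) : dual (c0 R) :=
  ell1_functional (ell1_finite_support (@delta_support R m)).

(** The disjunction covers both uses: coefficients of finite support (coordinate functionals) and
    vectors of finite support (unit vectors, sign vectors). *)
Lemma ell1_pairing_finite_support (R : realType) (b : R ^nat) (N : nat)
    (x : c0 R) :
  (forall n, (N <= n)%N -> b n = 0 \/ x n = 0) ->
  ell1_pairing b x = \sum_(0 <= i < N) b i * x i.
Proof.
move=> b0; apply/cvg_lim => //; apply: cvg_series_finite_support => n Nn.
by case: (b0 n Nn) => ->; rewrite ?mul0r ?mulr0.
Qed.

Lemma coordE (R : realType) (m : nat) (x : c0 R) : coord R m x = x m.
Proof.
rewrite [LHS](ell1_pairing_finite_support (N := m.+1)) ?sum_delta// => n mn.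
by left; exact: delta_support.
Qed.

Lemma ell1_pairing_unit (R : realType) (b : R ^nat) (m : nat) :
  ell1_pairing b (c0_unit R m) = b m.
Proof.
rewrite (ell1_pairing_finite_support (N := m.+1)); last first.
  by move=> n mn; right; exact: delta_support.
by under eq_bigr do rewrite mulrC; exact: sum_delta.
Qed.

(** * The [ell1] norm as dual norm *)

(** Test on the signs of [b], cut off at [N] so that they form a null sequence of norm at most 1. *)
Lemma sum_norm_le_dual_norm (R : realType) (b : R ^nat) (hb : ell1 b)
    (N : nat) :
  \sum_(0 <= i < N) `|b i| <= `|ell1_functional hb|.
Proof.
pose s n : R := if (n < N)%N then Num.sg (b n) else 0.
have s0 n : (N <= n)%N -> s n = 0 by rewrite /s ltnNge => ->.
pose x : c0 R := C0 (null_sequence_finite_support s0).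
have x1 : `|x| <= 1.
  apply: c0_norm_le => n; rewrite /= /s; case: ifP; rewrite ?normr0// => _.
  by rewrite normr_sg; case: (_ != _).
apply: le_trans (ler_dual_norm _ x1).
apply: le_trans (ler_norm _).
rewrite [leRHS](ell1_pairing_finite_support (N := N)); last first.
  by move=> n /s0; right.
rewrite big_nat [leRHS]big_nat; apply: ler_sum => i /andP[_ iN].
by rewrite /= /s iN mulrC normrEsg.
Qed.

Lemma ell1_functional_norm (R : realType) (b : R ^nat) (hb : ell1 b) :
  `|ell1_functional hb| = ell1_norm b.
Proof.
apply/eqP; rewrite eq_le; apply/andP; split.
  apply: dual_norm_le => x x1; apply: le_trans (ell1_pairing_le hb x) _.
  rewrite ler_piMr//; apply: limr_ge => //.
  by near=> n; exact: sumr_ge0.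
apply: limr_le => //; near=> n; exact: sum_norm_le_dual_norm.
Unshelve. all: by end_near. Qed.

Lemma sum_norm_le_ell1_norm (R : realType) (b : R ^nat) (hb : ell1 b)
    (N : nat) :
  \sum_(0 <= i < N) `|b i| <= ell1_norm b.
Proof. by rewrite -(ell1_functional_norm hb) sum_norm_le_dual_norm. Qed.

Lemma norm_le_ell1_norm (R : realType) (b : R ^nat) (hb : ell1 b) (n : nat) :
  `|b n| <= ell1_norm b.
Proof.
apply: le_trans (sum_norm_le_ell1_norm hb n.+1).
by rewrite big_nat_recr//= lerDr sumr_ge0.
Qed.

(** * The annihilator of the kernel, and norms of functionals shifted along it *)

Section kernel_of_functional.
Context (R : realType) (a : R ^nat) (a_ell1 : ell1 a).
Context (a_norm1 : ell1_norm a = 1).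
Let A : dual (c0 R) := ell1_functional a_ell1.

Let series_norm : series (fun n => `|a n|) @ \oo --> (1 : R).
Proof. by rewrite -a_norm1; exact: a_ell1. Qed.

Let A_neq0 : A != 0.
Proof. by rewrite -normr_eq0 ell1_functional_norm a_norm1 oner_neq0. Qed.

(** The kernel has codimension one: if [A x != 0], then [y - (A y / A x) *: x] lies in it for every
    [y], so [h] is determined by [h x]. *)
Lemma annihilator_c0_ker (h : dual (c0 R)) :
  annihilator (c0_ker a) h <-> exists t, h = t *: A.
Proof.
split=> [h0|[t ->] y y0]; last first.
  by rewrite [LHS](_ : _ = t * A y)// [A y]y0 mulr0.
have [x Ax] : exists x, A x != 0.
  apply/not_existsP => A0; move/eqP: A_neq0; apply.
  apply/val_inj/funext => x; have /negP := A0 x.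
  by rewrite negbK => /eqP.
exists (h x / A x); apply/val_inj/funext => y.
rewrite [RHS](_ : _ = h x / A x * A y)//=.
have : h (y - (A y / A x) *: x) = 0.
  apply: h0; rewrite /c0_ker/= -[LHS]/(A _) linearB linearZ/=.
  by rewrite divfK ?subrr.
by rewrite linearB linearZ/= => /eqP; rewrite subr_eq0 => /eqP ->; ring.
Qed.

(** The left side is the pairing with [a] after its [m]-th entry is deleted, a sequence of norm
    [1 - |a m|]. *)
Lemma ell1_pairing_sub_coord_le (m : nat) (x : c0 R) :
  `|A x - a m * x m| <= (1 - `|a m|) * `|x|.
Proof.
pose b n := if n == m then 0 else a n.
have normb : series (fun n => `|b n|) @ \oo --> 1 - `|a m|.
  (* The limit takes the form [l + (v - u m)] of [cvg_series_update], with [v = 0]. *)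
  rewrite -[- _]add0r; have -> : (fun n => `|b n|) =
      (fun n => if n == m then 0 else `|a n|).
    by apply/funext => n; rewrite /b; case: eqP => // _; rewrite normr0.
  exact: cvg_series_update.
have hb : ell1 b := cvgP _ normb.
have <- : ell1_norm b = 1 - `|a m| by exact: cvg_lim.
suff -> : A x - a m * x m = ell1_pairing b x by exact: ell1_pairing_le.
apply/esym/cvg_lim => //; rewrite -[- _]add0r.
have -> : (fun n => b n * x n) =
    (fun n => if n == m then 0 else a n * x n).
  by apply/funext => n; rewrite /b; case: eqP => // _; rewrite mul0r.
by apply: cvg_series_update; exact: ell1_pairing_cvg.
Qed.

(* Since [g] does not see the [m]-th coordinate, [x m] may be replaced by the
   sign that makes [t * a m] add up with [g x]. *)
Lemma dual_norm_add_multiple (m : nat) (g : dual (c0 R)) (t : R) :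
  g (c0_unit R m) = 0 ->
  `|g| + `|t| * (2 * `|a m| - 1) <= `|g + t *: A|.
Proof.
move=> gm; rewrite -lerBrDr; apply: dual_norm_le => x x1.
pose s : R := if (0 <= g x) == (0 <= t * a m) then 1 else -1.
pose y := x + (s - x m) *: c0_unit R m.
have s1 : `|s| = 1 by rewrite /s; case: ifP; rewrite ?normrN normr1.
have ym : y m = s.
  rewrite [LHS](_ : _ = x m + (s - x m) * delta R m m)// /delta eqxx.
  by rewrite mulr1 addrC subrK.
have y1 : `|y| <= 1.
  apply: c0_norm_le => n; have [->|nm] := eqVneq n m; first by rewrite ym s1.
  rewrite [y n](_ : _ = x n + (s - x m) * delta R m n)// /delta (negbTE nm).
  by rewrite mulr0 addr0; exact: le_trans (ler_c0_norm x n) x1.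
have gy : g y = g x by rewrite linearD linearZ/= gm mulr0 addr0.
rewrite lerBrDr; apply: le_trans (ler_dual_norm _ y1).
rewrite [(g + _) y](_ : _ = g y + t * A y)// gy; set r := A y - a m * s.
have r1 : `|r| <= 1 - `|a m|.
  rewrite /r -ym; apply: le_trans (ell1_pairing_sub_coord_le _ _) _.
  by rewrite ler_piMr// subr_ge0 -a_norm1 norm_le_ell1_norm.
(* By the choice of [s] the bracket has absolute value at least [|g x| + |t| |a m|]. The other
   coordinates, collected in [r], cost at most [|t| (1 - |a m|)]; the difference gives the factor
   [2 |a m| - 1]. *)
have -> : g x + t * A y = (g x + t * a m * s) + t * r by rewrite /r; ring.
have gt : `|g x| + `|t| * `|a m| <= `|g x + t * a m * s|.
  rewrite -normrM ler_normr /s.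
  by case: (ger0P (g x)); case: (ger0P (t * a m)) => ? ? /=; lra.
have tr : `|t * r| <= `|t| * (1 - `|a m|) by rewrite normrM ler_wpM2l.
have := lerB_normD (g x + t * a m * s) (t * r).
lra.
Qed.

(** The norm equals [|1 - t a_m| + |t| (1 - |a_m|)], which is at least [1 + |t| (1 - 2 |a_m|)]. *)
Lemma norm_coord_sub_multiple (m : nat) (t : R) :
  `|a m| <= 1 / 2 -> 1 <= `|coord R m - t *: A|.
Proof.
move=> am; pose b n := if n == m then 1 - t * a m else - t * a n.
have normb : series (fun n => `|b n|) @ \oo -->
    `|t| + (`|1 - t * a m| - `|t| * `|a m|).
  have -> : (fun n => `|b n|) =
      (fun n => if n == m then `|1 - t * a m| else `|t| * `|a n|).
    by apply/funext => n; rewrite /b; case: eqP; rewrite // normrM normrN.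
  apply: cvg_series_update; rewrite -[X in _ --> X]mulr1.
  have -> : series (fun n => `|t| * `|a n|) =
      (fun n => `|t| * series (fun n => `|a n|) n).
    by apply/funext => n; rewrite /series/= mulr_sumr.
  exact: cvgMr.
have hb : ell1 b := cvgP _ normb.
have -> : coord R m - t *: A = ell1_functional hb.
  apply/val_inj/funext => x.
  rewrite [LHS](_ : _ = coord R m x - t * A x)// coordE.
  apply/esym/cvg_lim => //.
  (* Again the form [l + (v - u m)], here for the series of [- t * (a n * x n)] with its [m]-th term
     replaced. *)
  have -> : x m - t * A x =
      - t * A x + ((1 - t * a m) * x m - (- t * (a m * x m))) by ring.
  have -> : (fun n => b n * x n) =
      (fun n => if n == m then (1 - t * a m) * x m else - t * (a n * x n)).
    by apply/funext => n; rewrite /b; case: eqP => [->|_]//; rewrite mulrA.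
  apply: (@cvg_series_update _ (fun n => - t * (a n * x n))).
  have -> : series (fun n => - t * (a n * x n)) =
      (fun n => - t * series (fun n => a n * x n) n).
    by apply/funext => n; rewrite /series/= mulr_sumr.
  by apply: cvgMr; exact: ell1_pairing_cvg.
rewrite ell1_functional_norm [ell1_norm b](cvg_lim _ normb)//.
have : 1 - `|t * a m| <= `|1 - t * a m|.
  by rewrite -[X in X - _](normr1 R); exact: lerB_dist.
rewrite normrM; have : `|t| * `|a m| <= `|t| * (1 / 2) by rewrite ler_wpM2l.
lra.
Qed.

(** The difference is the functional of the tail of [a] from index [N] on, whose norm is the mass
    left over by the first [N] entries. *)
Lemma norm_functional_sub_partial_sum (N : nat) :
  `|A - \sum_(0 <= i < N) a i *: coord R i| <= 1 - \sum_(0 <= i < N) `|a i|.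
Proof.
pose b n := if (n < N)%N then 0 else a n.
have bE n : (N <= n)%N -> b n = a n by rewrite /b ltnNge => ->.
have b0 n : (n < N)%N -> b n = 0 by rewrite /b => ->.
have normb : series (fun n => `|b n|) @ \oo --> 1 - \sum_(0 <= i < N) `|a i|.
  have -> : - \sum_(0 <= i < N) `|a i| = \sum_(0 <= i < N) (`|b i| - `|a i|).
    rewrite -sumrN; apply: eq_big_nat => i /= iN.
    by rewrite b0// normr0 sub0r.
  by apply: cvg_series_eventually_eq => // n /bE ->.
have hb : ell1 b := cvgP _ normb.
rewrite -(cvg_lim _ normb)// -[lim _]/(ell1_norm b) -(ell1_functional_norm hb).
rewrite [X in `|X| <= _](_ : _ = ell1_functional hb)//.
apply/val_inj/funext => x; apply/esym/cvg_lim => //.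
rewrite [X in _ --> X](_ : _ =
    A x + \sum_(0 <= i < N) (b i * x i - a i * x i)); last first.
  rewrite [LHS](_ : _ = A x - (\sum_(0 <= i < N) a i *: coord R i) x)//.
  congr (_ + _); rewrite (eq_big_nat _ _ (F2 := fun i => - (a i * x i))).
    rewrite sumrN; congr (- _).
    rewrite (big_morph (fun f : dual (c0 R) => f x) (id1 := 0) (op1 := +%R))//.
    by apply: eq_bigr => i _; rewrite -coordE.
  by move=> i /= iN; rewrite b0// mul0r sub0r.
apply: cvg_series_eventually_eq; first by move=> n /bE ->.
exact: ell1_pairing_cvg.
Qed.

End kernel_of_functional.

Unset Implicit Arguments.
Set Strict Implicit.

Theorem corollary6p6 (R : realType) (a : nat -> R)
    (a_ell1 : ell1 a) (a_norm1 : ell1_norm a = 1) :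
  property_SU (c0_ker a) <-> 1 / 2 < sup (range (fun n : nat => `|a n|)).
Proof.
(* [sup] bounds its set only once the set is known to be nonempty and bounded above; the bound 1
   comes from the norm of [a]. *)
have norm_a n : `|a n| <= sup (range (fun n : nat => `|a n|)).
  apply: sup_upper_bound; last by exists n.
  split; first by exists `|a 0%N|, 0%N.
  by exists 1 => _ [k _ <-]; rewrite -a_norm1 norm_le_ell1_norm.
split=> [[G [[G_submod GH G_dec] SU]]|]; last first.
  move=> /sup_gt[|_ [m _ <-] am]; first by exists `|a 0%N|, 0%N.
  have am0 : a m != 0 by rewrite -normr_gt0; lra.
  exists [set g | g (c0_unit R m) = 0]; split; last first.
    move=> f g h gm /(annihilator_c0_ker a_ell1 a_norm1)[t ->] -> tA0.
    apply: lt_le_trans (dual_norm_add_multiple a_ell1 a_norm1 t gm).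
    (* Strictness: [2 |a m| - 1] is positive, and [t] is nonzero because [t *: A] is. *)
    rewrite ltrDl mulr_gt0//; last lra.
    by rewrite normr_gt0; apply: contra_neq tA0 => ->; rewrite scale0r.
  split.
  - split; first exact: mem_set.
    move=> k f g /set_mem/= f0 /set_mem/= g0; apply/mem_set => /=.
    by rewrite [LHS](_ : _ = k * f (c0_unit R m) + g (c0_unit R m))// f0 g0
      mulr0 addr0.
  - apply/seteqP; split=> [f [/= fm /(annihilator_c0_ker a_ell1 a_norm1)]|f ->].
      move=> [t ft]; move: fm; rewrite ft.
      rewrite [X in X = 0](_ : _ = t * ell1_pairing a (c0_unit R m))//.
      rewrite ell1_pairing_unit => /eqP.
      by rewrite mulf_eq0 (negbTE am0) orbF => /eqP ->; rewrite scale0r.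
    by split => // y _.
  (* Since [A] takes the value [a m] at [e_m], this is the multiple of [A] whose removal makes [f]
     vanish there. *)
  - move=> f; pose t := f (c0_unit R m) / a m.
    exists (f - t *: ell1_functional a_ell1), (t *: ell1_functional a_ell1).
    split; last by rewrite subrK.
      rewrite /= [LHS](_ : _ =
        f (c0_unit R m) - t * ell1_pairing a (c0_unit R m))//.
      by rewrite ell1_pairing_unit /t divfK ?subrr.
    by apply/(annihilator_c0_ker a_ell1 a_norm1); exists t.
rewrite ltNge; apply/negP => sup_le.
pose A := ell1_functional a_ell1.
have normA : `|A| = 1 by rewrite ell1_functional_norm.
(* A nonzero [h] would force the norm of [g] strictly below that of [coord R n], which is at most 1;
   but [g] is [coord R n] minus a multiple of [A], so its norm is at least 1. *)
have G_coord n : G (coord R n).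
  have [g [h [Gg Hh e_gh]]] := G_dec (coord R n).
  have [h0|h0] := eqVneq h 0; first by rewrite e_gh h0 addr0.
  have := SU _ _ _ Gg Hh e_gh h0.
  have /(annihilator_c0_ker a_ell1 a_norm1)[t htA] := Hh.
  rewrite ltNge => /negP[]; apply: (@le_trans _ _ 1).
    by apply: dual_norm_le => x x1; rewrite coordE (le_trans (ler_c0_norm x n)).
  have -> : g = coord R n - t *: A by rewrite e_gh htA addrK.
  exact: norm_coord_sub_multiple (le_trans (norm_a n) sup_le).
have G_sum N : G (\sum_(0 <= i < N) a i *: coord R i).
  have [G0 GD] := G_submod; elim: N => [|N IH].
    by rewrite big_nil; exact: set_mem G0.
  rewrite big_nat_recr//= addrC; apply: set_mem.
  by apply: GD; exact: mem_set.
(* Past half of the total mass, the tail [A - p] has norm below [1 / 2]. *)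
have [N SN] : exists N, 1 / 2 < \sum_(0 <= i < N) `|a i|.
  have : \forall N \near \oo, 1 / 2 < series (fun n => `|a n|) N.
    have := cvgr_gt _ a_ell1; apply.
    by rewrite -[lim _]/(ell1_norm a) a_norm1; lra.
  by move=> [N _ /(_ N (leqnn N)) ?]; exists N.
pose p := \sum_(0 <= i < N) a i *: coord R i.
have AH : annihilator (c0_ker a) (- A).
  by apply/(annihilator_c0_ker a_ell1 a_norm1); exists (-1); rewrite scaleN1r.
have A0 : - A != 0 by rewrite -normr_eq0 normrN normA oner_neq0.
(* Applied to [p + (- A)], the norm condition puts [p] below [A - p] in norm, hence also below
   [1 / 2]. The triangle inequality for [A = (A - p) + p] then contradicts [|A| = 1]. *)
have := SU _ _ _ (G_sum N) AH erefl A0; rewrite -/p distrC.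
have := norm_functional_sub_partial_sum a_ell1 a_norm1 N; rewrite -/A -/p.
have := ler_normD (A - p) p; rewrite subrK normA.
lra.
Qed.
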